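(* There exists a set $E \subseteq \mathbb{Z}$ of density zero that is generalised polynomial but is not hereditary; that is, $E$ is a generalised polynomial set with $d(E)=0$ and there is a subset $E'\subseteq E$ that is not a generalised polynomial set.
   Context: The class of generalised polynomial maps $\mathbb{Z}\to\mathbb{R}$ is the smallest class of functions $\mathbb{Z}\to\mathbb{R}$ that contains all real constants and the identity and is closed under pointwise addition, multiplication, and replacing $f$ by $\lfloor f\rfloor$. A set $E\subseteq\mathbb{Z}$ is generalised polynomial if its characteristic function $1_E\colon\mathbb{Z}\to\{0,1\}$ is a generalised polynomial map. A generalised polynomial set $E$ is hereditary if every subset $E'\subseteq E$ is generalised polynomial. The density of $E\subseteq\mathbb{Z}$ is $d(E)=\lim_{N\to\infty}\frac{|E\cap[-N,N]|}{2N+1}$. *)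

(* Defs.v *)
From mathcomp Require Import all_boot all_order all_algebra finmap.
From mathcomp Require Import all_classical all_reals all_analysis.
Import numFieldNormedType.Exports.
Import Order.TTheory GRing.Theory Num.Theory.

Set Implicit Arguments.
Unset Strict Implicit.
Unset Printing Implicit Defensive.

Local Open Scope classical_set_scope.
Local Open Scope ring_scope.

Inductive gen_poly_map (R : realType) : (int -> R) -> Prop :=
| gen_poly_cst (c : R) : gen_poly_map (fun _ : int => c)
| gen_poly_id : gen_poly_map (fun n : int => n%:~R)
| gen_poly_add (f g : int -> R) :
    gen_poly_map f -> gen_poly_map g -> gen_poly_map (fun n => f n + g n)
| gen_poly_mul (f g : int -> R) :
    gen_poly_map f -> gen_poly_map g -> gen_poly_map (fun n => f n * g n)
| gen_poly_floor (f : int -> R) :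
    gen_poly_map f -> gen_poly_map (fun n => (Num.floor (f n))%:~R).

Definition gen_poly_set (R : realType) (E : set int) : Prop :=
  gen_poly_map (\1_E : int -> R).

(* E itself is among the subsets, so a hereditary set is in particular
   generalised polynomial. *)
Definition hereditary_gen_poly (R : realType) (E : set int) : Prop :=
  forall E' : set int, E' `<=` E -> gen_poly_set R E'.

(* [fset_set] is the empty finite set on an infinite argument; here its
   argument lies in a bounded interval of integers, hence is finite. *)
Definition count_upto (E : set int) (N : nat) : nat :=
  #|` fset_set (E `&` [set z : int | - N%:Z <= z <= N%:Z]) |.

Definition has_density (R : realType) (E : set int) (d : R) : Prop :=
  (fun N : nat => (count_upto E N)%:R / (2 * N + 1)%:R : R) @ \oo --> d.

(* Main.v *)
Require Import Defs.
From mathcomp Require Import all_boot all_order all_algebra finmap.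
From mathcomp Require Import all_classical all_reals all_analysis.
From mathcomp Require Import zify ring lra.
Import Order.TTheory GRing.Theory Num.Theory.

(** The set is E = {n : floor (n * {n sqrt 2}^2) = 0}, where {x} is the
    fractional part, that is, the set of n >= 0 with n * {n sqrt 2}^2 < 1.

    E is generalised polynomial: for an integer h, irrationality of sqrt 2 makes
    floor (1 - {h sqrt 2}) equal to 1 if h = 0 and to 0 otherwise, and this is
    applied to h = floor (n * {n sqrt 2}^2) ([gen_poly_slow_returns]).

    E has density zero: if n < n' are elements of E with n >= (4 K)^2, then
    d = n' - n satisfies |d sqrt 2 - p| < 1 / (4 K) for some integer p, whereas
    |2 d^2 - p^2| >= 1 forces |d sqrt 2 - p| >= 1 / (4 d).  So the gaps of E tend
    to infinity ([slow_returns_separated]).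

    E is nevertheless polynomially large at infinitely many scales: if
    p^2 + 1 = 2 q^2 then {q sqrt 2} < 1 / q, and all multiples k q with k^3 <= q
    lie in E; so with r^3 <= q < (r + 1)^3 there are at least r elements of E
    among the first (r + 1)^4 integers ([slow_returns_rich]).

    A set that rich is never hereditary, because generalised polynomials of
    bounded complexity leave only polynomially many traces on [0, N], while E has
    more than polynomially many subsets there.  The difficulty in this count is
    that the real coefficients are unbounded.  It is overcome by writing
    a = floor a + {a}: for integer valued functions h_i,
      floor (sum a_i h_i) = sum (floor a_i) h_i + floor (sum {a_i} h_i),
    so that, on the nonnegative integers, every generalised polynomial is a real
    linear combination of integer valued functions obtained from 1 and n by
    products and by floors of combinations with coefficients in [0, 1)
    ([gen_poly_level_span]).  Such functions of bounded complexity are bounded by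
    a power of N on [0, N].  Given the values of the h_i there, the values of
    floor (sum b_i h_i) are read off from the side of the point (1, b) with
    respect to polynomially many hyperplanes, and M hyperplanes cut a space of
    dimension r into at most (2 M + 1)^r pieces ([sign_patterns]).  Induction on
    the complexity bounds the number of traces ([tame_level]); this holds for
    final combinations with arbitrary real coefficients too, because only their
    position with respect to 1 matters ([few_level_traces]).  A subset of E that
    differs from all traces of complexity k inside the k-th of a sequence of
    disjoint windows then exists by counting ([diagonal_subset]). *)

Set Implicit Arguments.
Unset Strict Implicit.
Unset Printing Implicit Defensive.

Local Open Scope classical_set_scope.
Local Open Scope ring_scope.

(** * Maps with few values *)

Lemma leq_exp2rW m n e : (m <= n)%N -> (m ^ e <= n ^ e)%N.
Proof. by case: e => // e mn; rewrite leq_exp2r. Qed.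

Section Covers.
Local Open Scope nat_scope.

(** The bound is given by a covering list, so that no finiteness of A or of its
    image has to be carried along. *)
Definition few_values (X : Type) (T : eqType) (A : set X) (phi : X -> T)
    (B : nat) : Prop :=
  exists s : seq T, size s <= B /\ forall x, A x -> phi x \in s.

(** The form in which dependent choices are counted: first the value of phi, then
    the value of psi inside one fibre of phi. *)
Lemma few_values_fibre (X : Type) (T U : eqType) (A : set X) (phi : X -> T)
    (psi : X -> U) B B' :
  few_values A phi B ->
  (forall x, A x -> few_values [set y | A y /\ phi y = phi x] psi B') ->
  few_values A psi (B * B').
Proof.
move=> [s [ss sP]] fibP.
have /choice[g gP] t : exists u : seq U, size u <= B' /\
    forall x, A x -> phi x = t -> psi x \in u.
  have [[x [Ax xt]]|no] := pselect (exists x, A x /\ phi x = t).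
    have [u [su uP]] := fibP x Ax.
    by exists u; split=> // y Ay yt; apply: uP; split=> //; rewrite yt.
  by exists [::]; split=> // x Ax xt; case: no; exists x.
exists (flatten (map g s)); split; last first.
  move=> x Ax; apply/flattenP; exists (g (phi x)); first exact: map_f (sP _ Ax).
  by have [_] := gP (phi x); apply.
apply: leq_trans (leq_mul ss (leqnn B')); rewrite size_flatten.
elim: s {ss sP} => //= t s IH.
by rewrite mulSn leq_add //; case: (gP t).
Qed.

Lemma few_values_factor (X : Type) (T U : eqType) (A : set X) (phi : X -> T)
    (psi : X -> U) B :
  few_values A phi B ->
  (forall x y, A x -> A y -> phi x = phi y -> psi x = psi y) ->
  few_values A psi B.
Proof.
move=> fA det; rewrite -[B]muln1; apply: few_values_fibre fA _ => x Ax.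
exists [:: psi x]; split=> // y [Ay yx].
by rewrite inE; apply/eqP; apply: det.
Qed.

Lemma few_values_comp (X Y : Type) (T : eqType) (A : set X) (phi : X -> T)
    (C : set Y) (g : Y -> X) B :
  few_values A phi B -> (forall y, C y -> A (g y)) ->
  few_values C (fun y => phi (g y)) B.
Proof. by move=> [s [ss sP]] CA; exists s; split=> // y /CA; apply: sP. Qed.

Lemma few_values_cons (X : Type) (T : eqType) (A : set X) (phi : X -> T)
    (psi : X -> seq T) B B' :
  few_values A phi B -> few_values A psi B' ->
  few_values A (fun x => phi x :: psi x) (B * B').
Proof.
move=> fphi [s [ss sP]]; apply: few_values_fibre fphi _ => x Ax.
exists (map (cons (phi x)) s); split; first by rewrite size_map.
by move=> y [Ay ->]; apply: map_f; apply: sP.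
Qed.

Lemma few_values_family (X I : Type) (T : eqType) (A : set X)
    (phi : X -> I -> T) (r : seq I) B :
  (forall i, few_values A (phi^~ i) B) ->
  few_values A (fun x => map (phi x) r) (B ^ size r).
Proof.
move=> phiP; elim: r => [|i r IH] /=; first by exists [:: [::]]; split.
by rewrite expnS; apply: few_values_cons.
Qed.

End Covers.

(** * Sign patterns of linear forms *)

Section SignPatterns.
Variable F : realFieldType.

(** A new form c splits a sign pattern of the others only if the pattern is
    realised on both sides of the hyperplane c = 0; by convexity it is then
    realised on that hyperplane, where the dimension is smaller. *)
Lemma sign_patterns d (cs : seq 'cV[F]_d) (r : nat) (W : 'M[F]_d) :
  (\rank W <= r)%N ->
  few_values [set x : 'rV[F]_d | (x <= W)%MS]
    (fun x => [seq 0 <= (x *m c) 0 0 | c <- cs]) ((size cs).*2.+1 ^ r).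
Proof.
elim: cs r W => [|c cs IH] r W rW.
  by exists [:: [::]]; split=> [|x _] /=; rewrite ?exp1n ?inE.
have [Wc|nWc] := boolP (W <= kermx c)%MS.
  have [s [ss sP]] := IH r W rW.
  exists (map (cons true) s); split.
    by rewrite size_map (leq_trans ss) // leq_exp2rW //= ltnS leq_double.
  move=> x /= xW.
  have /sub_kermxP -> : (x <= kermx c)%MS by apply: submx_trans xW Wc.
  by rewrite mxE lexx map_f // sP.
have rcap : (\rank (W :&: kermx c)%MS < \rank W)%N.
  apply: rank_ltmx; rewrite /ltmx capmxSl /=; apply: contra nWc => h.
  exact: submx_trans h (capmxSr _ _).
case: r rW => [|r] rW; first by move: (leq_trans rcap rW); rewrite ltn0.
have [s [ss sP]] := IH _ W rW.
have [t [st tP]] := IH r _ (leq_trans rcap rW).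
(* For a pattern that does not occur on the hyperplane, [sgn] is its only side. *)
pose sgn (p : seq bool) : bool := `[< exists x : 'rV[F]_d,
  [/\ (x <= W)%MS, [seq 0 <= (x *m c') 0 0 | c' <- cs] = p &
      0 <= (x *m c) 0 0] >].
exists ([seq sgn p :: p | p <- s] ++ [seq true :: p | p <- t]
        ++ [seq false :: p | p <- t]); split.
  rewrite !size_cat !size_map /= addnn.
  apply: leq_trans (leq_add ss (_ : _ <= ((size cs).*2.+1 ^ r).*2)%N) _.
    by rewrite leq_double.
  rewrite doubleS; set M := _.*2.+1.
  by rewrite !expnS -mul2n -mulnDl addn2 leq_mul // leq_exp2rW // ltnW.
move=> x /= xW; set p := map _ _; rewrite !mem_cat.
case: (boolP (0 <= _)) => fx.
  have -> : true = sgn p by apply/esym/asboolP; exists x.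
  by rewrite map_f // sP.
have [sp|] := boolP (sgn p); last first.
  by move=> /negbTE <-; rewrite map_f // sP.
move/asboolP: sp => [y [yW yp fy]].
rewrite -ltNge in fx; set a := (x *m c) 0 0 in fx; set b := (y *m c) 0 0 in fy.
(* The point of the segment from x to y, up to scaling, where c vanishes. *)
pose z := b *: x + (- a) *: y.
have zE c' : (z *m c') 0 0 = b * (x *m c') 0 0 - a * (y *m c') 0 0.
  by rewrite mulmxDl -!scalemxAl !mxE mulNr.
have zk : (z <= kermx c)%MS.
  apply/sub_kermxP/matrixP => i j; rewrite !ord1 zE [RHS]mxE -/a -/b; ring.
have zW : (z <= W :&: kermx c)%MS.
  by rewrite sub_capmx zk addmx_sub // scalemx_sub.
have zp : [seq 0 <= (z *m c') 0 0 | c' <- cs] = p.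
  rewrite /p; apply/eq_in_map => c' c'cs; rewrite zE.
  have : (0 <= (y *m c') 0 0) = (0 <= (x *m c') 0 0).
    by move/eq_in_map: yp => ->.
  case: (boolP (0 <= (x *m c') 0 0)) => [h1 h2|h1 /negbT h2].
    by rewrite subr_ge0 (le_trans (y := 0)) // ?mulr_ge0 // mulr_le0_ge0 // ltW.
  apply/negbTE; rewrite -ltNge subr_lt0; rewrite -!ltNge in h1 h2.
  by apply: (@le_lt_trans _ _ 0); rewrite ?mulr_ge0_le0 ?(ltW h1) ?nmulr_rgt0.
by rewrite [X in _ || (_ || X)]map_f ?orbT // -zp tP.
Qed.
End SignPatterns.

(** * Traces of generalised polynomials of bounded complexity *)

Section Combinations.
Variable R : realType.

Definition comb k (x : ('I_k -> R) * ('I_k -> nat -> int)) (n : nat) : R :=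
  \sum_(i < k) x.1 i * (x.2 i n)%:~R.

(** Once the traces of the functions x.2 i are fixed, the conditions
    m <= comb x n are sign conditions on linear forms at the point (1, x.1). *)
Lemma few_comb_signs k (F : set (nat -> int)) N B (ms : seq int) :
  few_values F (fun f => mkseq f N.+1) B ->
  few_values [set x : ('I_k -> R) * ('I_k -> nat -> int) | forall i, F (x.2 i)]
    (fun x => [seq m%:~R <= comb x n | n <- iota 0 N.+1, m <- ms])
    (B ^ k * ((N.+1 * size ms).*2.+1) ^ k.+1).
Proof.
move=> fF.
have fam := @few_values_family (('I_k -> R) * ('I_k -> nat -> int)) 'I_k _
  [set x | forall i, F (x.2 i)] (fun x i => mkseq (x.2 i) N.+1) (enum 'I_k) B
  (fun i => few_values_comp fF (fun y Fy => Fy i)).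
rewrite size_enum_ord in fam.
apply: few_values_fibre fam _ => x0 Fx0 /=.
pose c n m : 'cV[R]_(1 + k) :=
  col_mx (- m%:~R)%:M (\col_i (x0.2 i n)%:~R).
pose cs := [seq c n m | n <- iota 0 N.+1, m <- ms].
have rW : (\rank (1%:M : 'M[R]_(1 + k)) <= k.+1)%N by rewrite mxrank1.
pose v (x : ('I_k -> R) * ('I_k -> nat -> int)) : 'rV[R]_(1 + k) :=
  row_mx 1%:M (\row_i x.1 i).
have scs : size cs = (N.+1 * size ms)%N by rewrite size_allpairs size_iota.
rewrite -scs.
apply: few_values_factor (few_values_comp (g := v) (sign_patterns cs rW) _) _.
  by move=> y _ /=; apply: submx1.
suff E x : (forall i, F (x.2 i)) -> [seq mkseq (x.2 i) N.+1 | i <- enum 'I_k] =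
    [seq mkseq (x0.2 i) N.+1 | i <- enum 'I_k] ->
    [seq m%:~R <= comb x n | n <- iota 0 N.+1, m <- ms] =
    [seq 0 <= (v x *m c) 0 0 | c <- cs].
  move=> x y [Fx xE] [Fy yE] xy.
  exact: etrans (E _ Fx xE) (etrans xy (esym (E _ Fy yE))).
move=> Fx /eq_in_map xE; rewrite /cs map_allpairs.
apply/eq_in_allpairs => n m; rewrite mem_iota add0n /= => nN _.
rewrite mul_row_col mul_scalar_mx scale1r !mxE eqxx mulr1n.
rewrite addrC subr_ge0; congr (_ <= _); apply: eq_bigr => i _.
rewrite !mxE; congr (_ * _%:~R).
have := congr1 (fun s => nth 0 s n) (xE i (mem_enum _ _)).
by rewrite !nth_mkseq.
Qed.

(** Complexity classes of integer valued functions.  The same k bounds the depth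
    and the number of summands under a floor.  Coefficients are confined to
    [0, 1): with arbitrary ones the classes would not be [tame].  Sums are
    not included because [level_span] provides them. *)
Fixpoint level (k : nat) : set (nat -> int) :=
  if k is k'.+1 then
    [set f | [\/ level k' f,
       exists g h, [/\ level k' g, level k' h & f = fun n => g n * h n] |
       exists x : ('I_k' -> R) * ('I_k' -> nat -> int),
         [/\ forall i, 0 <= x.1 i < 1, forall i, level k' (x.2 i) &
             f = fun n => Num.floor (comb x n)]]]
  else [set f | f = (fun=> 1) \/ f = Posz].

(** The base N + 2 >= 2 lets constants and sums be absorbed into the exponent. *)
Definition tame (F : set (nat -> int)) := exists C, forall N,
  few_values F (fun f => mkseq f N.+1) (N.+2 ^ C) /\
  forall f n, F f -> (n <= N)%N -> (`|f n| <= N.+2 ^ C)%N.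

Lemma comb_bound k (x : ('I_k -> R) * ('I_k -> nat -> int)) n (H : nat) :
  (forall i, 0 <= x.1 i < 1) -> (forall i, (`|x.2 i n| <= H)%N) ->
  `|comb x n| <= (k * H)%:R.
Proof.
move=> x1 x2; apply: le_trans (ler_norm_sum _ _ _) _.
have -> : (k * H)%:R = \sum_(i < k) H%:R :> R.
  by rewrite sumr_const card_ord natrM mulr_natl.
apply: ler_sum => i _; rewrite normrM -[leRHS]mul1r.
have /andP[x0 xl] := x1 i.
apply: ler_pM => //; first by rewrite ger0_norm // ltW.
by rewrite -intr_norm -natr_absz ler_nat.
Qed.

Lemma tame_level0 : tame (level 0).
Proof.
exists 1%N => N; split.
  exists [:: mkseq (fun=> 1) N.+1; mkseq Posz N.+1]; split=> //.
  by move=> f [] ->; rewrite !inE eqxx ?orbT.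
by move=> f n [] -> nN //=; rewrite expn1; lia.
Qed.

Lemma tameU F G : tame F -> tame G -> tame (F `|` G).
Proof.
move=> [C CP] [D DP]; exists (maxn C D).+1 => N.
have [[s [ss sP]] bF] := CP N; have [[t [st tP]] bG] := DP N.
have le1 : (N.+2 ^ C <= N.+2 ^ maxn C D)%N by rewrite leq_pexp2l // leq_maxl.
have le2 : (N.+2 ^ D <= N.+2 ^ maxn C D)%N by rewrite leq_pexp2l // leq_maxr.
have le3 : (2 * N.+2 ^ maxn C D <= N.+2 ^ (maxn C D).+1)%N.
  by rewrite expnS leq_mul.
split; last first.
  by move=> f n [/bF|/bG] fn nN; have := fn n nN; lia.
exists (s ++ t); rewrite size_cat; split; first by lia.
by move=> f [/sP|/tP] h; rewrite mem_cat h ?orbT.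
Qed.

Lemma tameM F : tame F ->
  tame [set f | exists g h, [/\ F g, F h & f = fun n => g n * h n]].
Proof.
move=> [C CP]; exists (C + C)%N => N; have [fF bF] := CP N.
rewrite expnD; split; last first.
  move=> f n [g [h [Fg Fh ->]]] nN.
  by rewrite abszM leq_mul ?bF.
have [s [ss sP]] := fF.
pose mul (u v : seq int) := mkseq (fun n => nth 0 u n * nth 0 v n) N.+1.
exists [seq mul u v | u <- s, v <- s]; split.
  by rewrite size_allpairs leq_mul.
move=> f [g [h [Fg Fh ->]]]; apply/allpairsP.
exists (mkseq g N.+1, mkseq h N.+1); split=> /=; rewrite ?sP //.
apply/eq_in_map => n; rewrite mem_iota add0n /= => nN.
by rewrite !nth_mkseq.
Qed.

(** The values of comb x are at most k (N + 2)^C in absolute value, so the floor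
    is determined by comparing comb x with the integers in that range. *)
Lemma tame_floor k F : tame F ->
  tame [set f | exists x : ('I_k -> R) * ('I_k -> nat -> int),
         [/\ forall i, 0 <= x.1 i < 1, forall i, F (x.2 i) &
             f = fun n => Num.floor (comb x n)]].
Proof.
move=> [C CP].
pose D := (k + C + 5)%N; exists (C * k + D * k.+1)%N => N.
have [fF bF] := CP N; set Z := N.+2; set H := (Z ^ C)%N in fF bF *.
have Zk : (k < Z ^ k)%N.
  by apply: leq_trans (ltn_expl k (isT : 1 < 2)%N) _; apply: leq_exp2rW.
have H0 : (0 < H)%N by rewrite expn_gt0.
have kH : ((k * H).+2 <= Z ^ (k + C + 1))%N.
  rewrite !expnD expn1 -/H.
  have h1 : (k * H + H <= Z ^ k * H)%N by rewrite -mulSnr leq_mul.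
  have h2 : (Z ^ k * H * 2 <= Z ^ k * H * Z)%N by rewrite leq_mul.
  nia.
have xb (x : ('I_k -> R) * ('I_k -> nat -> int)) n :
    (forall i, 0 <= x.1 i < 1) -> (forall i, F (x.2 i)) -> (n <= N)%N ->
    (`|Num.floor (comb x n)| <= (k * H).+1)%N.
  move=> x1 x2 nN.
  have := @comb_bound k x n H x1 (fun i => bF _ _ (x2 i) nN).
  rewrite ler_norml => /andP[lo hi].
  have l1 : - (k * H)%:Z <= Num.floor (comb x n).
    by rewrite floor_ge_int rmorphN.
  have l2 : Num.floor (comb x n) <= (k * H)%:Z.
    by rewrite -(ler_int R); apply: le_trans hi; apply: floor_le.
  by lia.
split; last first.
  move=> f n [x [x1 x2 ->]] nN; apply: leq_trans (xb x n x1 x2 nN) _.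
  apply: leq_trans (leq_trans (leqnSn _) kH) _.
  rewrite leq_pexp2l // /D; nia.
pose ms := [seq (i%:Z - (k * H).+1%:Z) | i <- iota 0 ((k * H).+1).*2.+1].
have fS := @few_comb_signs k F N H ms fF.
have [||s [ss sP]] := @few_values_factor _ _ _
  [set x : ('I_k -> R) * ('I_k -> nat -> int) |
     (forall i, F (x.2 i)) /\ forall i, 0 <= x.1 i < 1] _
  (fun x => mkseq (fun n => Num.floor (comb x n)) N.+1) _
  (few_values_comp (g := id) fS _) _.
- by move=> x [].
- move=> x y [x2 x1] [y2 y1] xy.
  have key (z t : ('I_k -> R) * ('I_k -> nat -> int)) n :
      [seq m%:~R <= comb z n | n <- iota 0 N.+1, m <- ms] =
      [seq m%:~R <= comb t n | n <- iota 0 N.+1, m <- ms] -> (n <= N)%N ->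
      (forall i, F (z.2 i)) -> (forall i, 0 <= z.1 i < 1) ->
      Num.floor (comb z n) <= Num.floor (comb t n).
    move=> E nN z2 z1; rewrite floor_ge_int.
    have mms : Num.floor (comb z n) \in ms.
      have b := xb z n z1 z2 nN.
      apply/mapP; exists (absz (Num.floor (comb z n) + (k * H).+1%:Z)); last by lia.
      by rewrite mem_iota; lia.
    move/eq_in_allpairs: E => /(_ n _ _ mms) <-; first by apply: floor_le.
    by rewrite mem_iota.
  apply/eq_in_map => n; rewrite mem_iota add0n /= ltnS => nN.
  by apply/eqP; rewrite eq_le !key.
exists s; split; last by move=> f [x [x1 x2 ->]]; apply: sP.
apply: leq_trans ss _; rewrite expnD leq_mul //.
  by rewrite /H -expnM.
rewrite [leqRHS]expnM leq_exp2rW // size_map size_iota /D.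
have -> : (k + C + 5 = (k + C + 1) + 4)%N by lia.
rewrite expnD; move: kH; set Y := (Z ^ (k + C + 1))%N => kH.
have h1 : (4 * N.+1 * Y < Y * Z ^ 4)%N.
  rewrite mulnC ltn_pmul2l; last by lia.
  apply: (@leq_trans (Z ^ 3)%N); last by rewrite leq_pexp2l.
  by rewrite !expnS expn0 /Z; nia.
have h2 : (N.+1 * (k * H).+1.*2.+1 <= N.+1 * Y.*2)%N by rewrite leq_mul //; lia.
lia.
Qed.

Lemma levelS k : level k `<=` level k.+1.
Proof. by move=> f kf; constructor 1. Qed.

Lemma level_mono j k : (j <= k)%N -> level j `<=` level k.
Proof.
move=> /subnKC <-; elim: (k - j)%N => [|m IH]; first by rewrite addn0.
by rewrite addnS => f /IH; apply: levelS.
Qed.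

Lemma level_one k : level k (fun=> 1).
Proof. by apply: (level_mono (leq0n k)); left. Qed.

Lemma tame_sub F G : F `<=` G -> tame G -> tame F.
Proof.
move=> FG [C CP]; exists C => N; have [[s [ss sP]] bG] := CP N.
split; first by exists s; split=> // f /FG /sP.
by move=> f n /FG; apply: bG.
Qed.

Lemma tame_level k : tame (level k).
Proof.
elim: k => [|k IH]; first exact: tame_level0.
apply: tame_sub (tameU IH (tameU (tameM IH) (tame_floor k IH))).
by move=> f [fk|fM|fF]; [left|right; left|right; right].
Qed.

(** The real span of all classes [level k], which turns out to contain the
    restrictions of all generalised polynomials to the nonnegative integers. *)
Definition level_span (f : nat -> R) : Prop :=
  exists k (s : seq (R * (nat -> int))),
    (forall p, p \in s -> level k p.2) /\
    forall n, f n = \sum_(p <- s) p.1 * (p.2 n)%:~R.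

(** Padding by zero coefficients gives all sums of at most k terms the same
    shape; K records a condition on coefficients that must survive it. *)
Lemma sum_comb k (s : seq (R * (nat -> int))) (K : set R) :
  (size s <= k)%N -> K 0 -> (forall p, p \in s -> K p.1 /\ level k p.2) ->
  exists x : ('I_k -> R) * ('I_k -> nat -> int),
    [/\ forall i, K (x.1 i), forall i, level k (x.2 i) &
        forall n, \sum_(p <- s) p.1 * (p.2 n)%:~R = comb x n].
Proof.
move=> sk K0 sP; pose p0 : R * (nat -> int) := (0, fun=> 1).
have nthP i : K (nth p0 s i).1 /\ level k (nth p0 s i).2.
  have [si|si] := ltnP i (size s); first by apply/sP/mem_nth.
  by rewrite nth_default //; split=> //; apply: level_one.
exists (fun i : 'I_k => (nth p0 s i).1, fun i : 'I_k => (nth p0 s i).2).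
split=> [i|i|n]; [by case: (nthP i)|by case: (nthP i)|].
rewrite /comb /= (big_nth p0) big_mkord.
rewrite (big_ord_widen k (fun i => (nth p0 s i).1 * ((nth p0 s i).2 n)%:~R) sk).
rewrite big_mkcond; apply: eq_bigr => i _; case: ifPn => //.
by rewrite -leqNgt => si; rewrite nth_default // mul0r.
Qed.

Lemma level_spanD f g : level_span f -> level_span g ->
  level_span (fun n => f n + g n).
Proof.
move=> [k [s [sP fE]]] [l [t [tP gE]]]; exists (maxn k l), (s ++ t); split.
  move=> p; rewrite mem_cat => /orP[/sP|/tP]; apply: level_mono.
    exact: leq_maxl.
  exact: leq_maxr.
by move=> n; rewrite big_cat /= fE gE.
Qed.

Lemma level_spanM f g : level_span f -> level_span g ->
  level_span (fun n => f n * g n).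
Proof.
move=> [k [s [sP fE]]] [l [t [tP gE]]].
exists (maxn k l).+1, [seq (p.1 * q.1, fun n => p.2 n * q.2 n) | p <- s, q <- t].
split.
  move=> _ /allpairsP[[p q] [/= ps qt ->]] /=; constructor 2.
  exists p.2, q.2; split=> //.
    exact: level_mono (leq_maxl k l) _ (sP _ ps).
  exact: level_mono (leq_maxr k l) _ (tP _ qt).
move=> n; rewrite fE gE big_allpairs_dep mulr_suml; apply: eq_bigr => p _.
rewrite mulr_sumr; apply: eq_bigr => q _ /=.
by rewrite intrM mulrACA.
Qed.

(** Integer parts of the coefficients leave the floor:
    floor (sum a_i h_i) = sum (floor a_i) h_i + floor (sum {a_i} h_i). *)
Lemma level_span_floor f : level_span f ->
  level_span (fun n => (Num.floor (f n))%:~R).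
Proof.
move=> [k [s [sP fE]]].
pose frac (p : R * (nat -> int)) := (p.1 - (Num.floor p.1)%:~R, p.2).
pose m := maxn k (size s).
have [|||x [x1 x2 xE]] := @sum_comb m (map frac s) [set r | 0 <= r < 1].
- by rewrite size_map leq_maxr.
- by rewrite /= lexx ltr01.
- move=> _ /mapP[p ps ->] /=; split; last first.
    exact: level_mono (leq_maxl _ _) _ (sP _ ps).
  by have /andP[] := floor_itv p.1; rewrite intrD; lra.
exists m.+1, ((1, fun n => Num.floor (comb x n)) ::
  [seq ((Num.floor p.1)%:~R, p.2) | p <- s]); split.
  move=> p; rewrite inE => /orP[/eqP ->|/mapP[q qs ->]] /=.
    by constructor 3; exists x.
  by apply: levelS; apply: level_mono (leq_maxl _ _) _ (sP _ qs).
move=> n; rewrite big_cons mul1r /= -xE !big_map /=.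
have -> : f n = \sum_(p <- s) (p.1 - (Num.floor p.1)%:~R) * (p.2 n)%:~R +
    (\sum_(p <- s) Num.floor p.1 * p.2 n)%:~R.
  rewrite fE rmorph_sum -big_split /=; apply: eq_bigr => p _.
  by rewrite intrM mulrBl subrK.
rewrite floorDrz; last by rewrite intr_int.
rewrite intrKfloor intrD rmorph_sum /=; congr (_ + _).
by apply: eq_bigr => p _; rewrite intrM.
Qed.

Lemma gen_poly_level_span (f : int -> R) :
  gen_poly_map f -> level_span (fun n => f n%:Z).
Proof.
elim=> [c||g h _ Sg _ Sh|g h _ Sg _ Sh|g _ Sg].
- exists 0%N, [:: (c, fun=> 1)]; split.
    by move=> p; rewrite inE => /eqP ->; left.
  by move=> n; rewrite big_seq1 mulr1.
- exists 0%N, [:: (1, Posz)]; split.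
    by move=> p; rewrite inE => /eqP ->; right.
  by move=> n; rewrite big_seq1 mul1r.
- exact: level_spanD.
- exact: level_spanM.
- exact: level_span_floor.
Qed.

(** An indicator function that lies in the span is recovered by comparison with 1,
    so the coefficients need not be reduced modulo 1 here. *)
Definition level_traces (k : nat) : set (nat -> bool) :=
  [set e | exists x : ('I_k -> R) * ('I_k -> nat -> int),
     (forall i, level k (x.2 i)) /\ e = fun n => 1 <= comb x n].

Lemma few_level_traces k : exists C, forall N,
  few_values (level_traces k) (fun e => mkseq e N.+1) (N.+2 ^ C).
Proof.
have [C CP] := tame_level k; exists (C * k + 2 * k.+1)%N => N.
have [fF _] := CP N.
have [|s [ss sP]] := few_values_factor
    (psi := fun x => mkseq (fun n => 1 <= comb x n) N.+1)
    (few_comb_signs k [:: 1] fF).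
  move=> x y _ _ /eq_in_allpairs xy; apply/eq_in_map => n nN.
  exact: xy n 1 nN (mem_head _ _).
exists s; split; last by move=> e [x [xP ->]]; apply: sP.
apply: leq_trans ss _; rewrite expnD expnM leq_mul // expnM leq_exp2rW //=.
by rewrite muln1 !expnS expn0; nia.
Qed.

Lemma gen_poly_set_trace (E : set int) : gen_poly_set R E ->
  exists k, level_traces k (fun n => `[< E n%:Z >]).
Proof.
move=> /gen_poly_level_span [k [s [sP sE]]].
pose m := maxn k (size s).
have [||| x [_ x2 xE]] := @sum_comb m s setT; rewrite ?leq_maxr //.
  by move=> p /sP; split=> //; apply: level_mono (leq_maxl _ _) _ _.
exists m, x; split=> //; apply/funext => n; rewrite -xE -sE indicE.
have -> : `[< E n%:Z >] = (n%:Z \in E) by apply/asboolP/idP; rewrite in_setE.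
by case: (_ \in E); rewrite ?lexx ?ler10.
Qed.

End Combinations.

(** * Diagonalisation *)

Section Diagonal.
Local Open Scope nat_scope.

(** There are 2 ^ size s subsets of s, so one of them is not the restriction of
    any member of P. *)
Lemma escape_trace (P : set (nat -> bool)) (s : seq nat) m N B :
  few_values P (fun e => mkseq e N.+1) B -> uniq s ->
  (forall n, n \in s -> m < n <= N) -> B < 2 ^ size s ->
  exists A : nat -> bool, (forall n, A n -> n \in s) /\
    forall e, P e -> exists n, m < n <= N /\ e n <> A n.
Proof.
move=> [T [sT TP]] us sN lt; set t := size s in lt *.
pose read (l : seq bool) := [tuple nth false l (nth 0 s i) | i < t].
have [w wT] : exists w : t.-tuple bool, w \notin map read T.
  apply: contrapT => no.
  have all w : w \in map read T.
    by apply/negPn/negP => wT; apply: no; exists w.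
  have := card_size (map read T); rewrite size_map.
  have -> : #|map read T| = #|{: t.-tuple bool}|.
    by apply: eq_card => w; rewrite all.
  by rewrite card_tuple card_bool leqNgt (leq_ltn_trans sT lt).
exists (fun n => (n \in s) && nth false w (index n s)); split.
  by move=> n /andP[].
move=> e Pe; apply: contrapT => no; move/negP: wT; apply.
suff -> : w = read (mkseq e N.+1) by apply: map_f; apply: TP.
apply: eq_from_tnth => i; rewrite tnth_mktuple.
have si : nth 0 s i \in s by rewrite mem_nth.
have /andP[mi iN] := sN _ si.
rewrite nth_mkseq // (tnth_nth false).
have [ei|ei] := eqVneq (e (nth 0 s i)) (nth false w i); first by [].
case: no; exists (nth 0 s i); split; first by rewrite mi.
by rewrite si index_uniq // => h; rewrite h eqxx in ei.
Qed.

(** E' is assembled from windows (M k, M k.+1], where the part of E' in the k-th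
    window escapes P k. *)
Lemma diagonal_subset (E : set nat) (P : nat -> set (nat -> bool)) :
  (forall k, exists C, forall N,
     few_values (P k) (fun e => mkseq e N.+1) (N.+2 ^ C)) ->
  (forall C m, exists N (s : seq nat),
     [/\ uniq s, forall n, n \in s -> m < n <= N /\ E n &
         N.+2 ^ C < 2 ^ size s]) ->
  exists2 E' : set nat, E' `<=` E &
    forall k, ~ P k (fun n => `[< E' n >]).
Proof.
move=> fP richE.
have /choice[g gP] (km : nat * nat) : exists NA : nat * (nat -> bool),
    [/\ km.2 <= NA.1, forall n, NA.2 n -> E n &
      forall e, P km.1 e -> exists n, km.2 < n <= NA.1 /\ e n <> NA.2 n].
  case: km => k m /=; have [C CP] := fP k.
  have [N [s [us sN lt]]] := richE C m.
  have [|A [As AP]] := escape_trace (m := m) (CP N) us _ lt.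
    by move=> n /sN [].
  exists (N, A); split=> //=; last by move=> n /As /sN [].
  case: s us sN lt {As} => [|n s] us sN lt.
    by move: lt; rewrite expn0 ltnS leqn0 expn_eq0.
  by have [/andP[mn nN] _] := sN n (mem_head _ _); apply: leq_trans nN; apply: ltnW.
pose M := fix M k := if k is k'.+1 then (g (k', M k')).1 else 0.
have MS k : M k <= M k.+1 by have [] := gP (k, M k).
have Mmono : {homo M : i j / i <= j}.
  by apply: homo_leq => //; apply: leq_trans.
exists [set n | exists k, M k < n <= M k.+1 /\ (g (k, M k)).2 n].
  by move=> n [k [_]]; have [_ + _] := gP (k, M k); apply.
move=> k /=; have [_ _ H] := gP (k, M k) => /H[/= n [nk]]; apply.
apply/asboolP/idP => [[j [nj]]|An]; last by exists k.
suff -> : j = k by [].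
have /andP[lj uj] := nj; have /andP[lk uk] := nk.
have [jk|kj|//] := ltngtP j k.
  by have := leq_ltn_trans (leq_trans uj (Mmono _ _ jk)) lk; rewrite ltnn.
by have := leq_ltn_trans (leq_trans uk (Mmono _ _ kj)) lj; rewrite ltnn.
Qed.

End Diagonal.

Lemma not_hereditary_of_rich (R : realType) (E : set int) :
  (forall C m : nat, exists (N : nat) (s : seq nat),
     [/\ uniq s, forall n, n \in s -> (m < n <= N)%N /\ E n%:Z &
         (N.+2 ^ C < 2 ^ size s)%N]) ->
  ~ hereditary_gen_poly R E.
Proof.
move=> richE her.
have [E' E'E noP] := @diagonal_subset [set n | E n%:Z] (@level_traces R)
  (@few_level_traces R) richE.
have [|k] := @gen_poly_set_trace R (Posz @` E').
  by apply: her => _ [n /E'E ? <-].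
suff -> : (fun n : nat => `[< (Posz @` E') n%:Z >]) = fun n => `[< E' n >].
  exact: noP.
apply/funext => n; congr (asbool _); apply/propext; split; last by exists n.
by case=> j jE [<-].
Qed.

(** * A sparse set of slow returns of the rotation by the square root of 2 *)

Section SparseSet.
Variable R : realType.
Local Notation s2 := (Num.sqrt 2 : R).

Definition frac_part (x : R) : R := x - (Num.floor x)%:~R.

Lemma frac_part_itv x : 0 <= frac_part x < 1.
Proof. by have /andP[] := floor_itv x; rewrite /frac_part intrD; lra. Qed.

Lemma gen_poly_frac_part (f : int -> R) :
  gen_poly_map f -> gen_poly_map (fun n => frac_part (f n)).
Proof.
move=> Gf; have -> : (fun n => frac_part (f n)) =
    (fun n => f n + (-1) * (Num.floor (f n))%:~R).
  by apply/funext => n; rewrite mulN1r.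
apply: gen_poly_add => //; apply: gen_poly_mul; first exact: gen_poly_cst.
exact: gen_poly_floor.
Qed.

(** The 2-adic valuations of the two sides have different parity. *)
Lemma sqr_neq_double (p d : int) : p ^+ 2 = 2 * d ^+ 2 -> d = 0.
Proof.
move=> /(congr1 absz); rewrite abszX abszM abszX /= => e.
case: (eqVneq d 0) => // d0; have d1 : (0 < `|d|)%N by rewrite absz_gt0.
have := congr1 (fun n => odd (logn 2 n)) e.
by rewrite lognM ?expn_gt0 ?d1 // !lognX oddD !oddM.
Qed.

Lemma sqrt2_sqr : s2 ^+ 2 = 2.
Proof. by rewrite sqr_sqrtr. Qed.

(** The product is |2 d^2 - p^2|, a nonzero integer. *)
Lemma sqrt2_gap (p d : int) : d != 0 ->
  1 <= `|s2 * d%:~R - p%:~R| * `|s2 * d%:~R + p%:~R|.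
Proof.
move=> d0; rewrite -normrM.
have -> : (s2 * d%:~R - p%:~R) * (s2 * d%:~R + p%:~R) =
    (2 * d ^+ 2 - p ^+ 2)%:~R.
  rewrite !(intrD, intrM, rmorphN, rmorphXn) /=.
  transitivity (s2 ^+ 2 * d%:~R ^+ 2 - p%:~R ^+ 2); first by ring.
  by rewrite sqrt2_sqr.
rewrite -intr_norm -[1]/(1%:~R) ler_int.
have : 2 * d ^+ 2 - p ^+ 2 != 0.
  by apply: contra d0; rewrite subr_eq0 => /eqP/esym/sqr_neq_double/eqP.
lia.
Qed.

Lemma frac_part_sqrt2_eq0 (h : int) : (frac_part (s2 * h%:~R) == 0) = (h == 0).
Proof.
apply/eqP/eqP => [e|->]; last by rewrite mulr0 /frac_part floor0 subr0.
apply/eqP/negPn/negP => h0.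
have := sqrt2_gap (Num.floor (s2 * h%:~R)) h0.
by rewrite -/(frac_part _) e normr0 mul0r ler10.
Qed.

Definition slow_return (n : int) : int :=
  Num.floor (n%:~R * frac_part (s2 * n%:~R) ^+ 2).

Definition slow_returns : set int := [set n | slow_return n = 0].

(** For an integer h, floor (1 - {h sqrt 2}) is the indicator of h = 0. *)
Lemma gen_poly_slow_returns : gen_poly_set R slow_returns.
Proof.
have Gh : gen_poly_map (fun n : int => (slow_return n)%:~R : R).
  apply: gen_poly_floor; apply: gen_poly_mul; first exact: gen_poly_id.
  have Gf : gen_poly_map (fun n : int => frac_part (s2 * n%:~R)).
    apply: gen_poly_frac_part; apply: gen_poly_mul; first exact: gen_poly_cst.
    exact: gen_poly_id.
  exact: (gen_poly_mul Gf Gf).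
rewrite /gen_poly_set; have -> : (\1_slow_returns : int -> R) = fun n =>
    (Num.floor (1 + (-1) * frac_part (s2 * (slow_return n)%:~R)))%:~R.
  apply/funext => n; rewrite indicE mulN1r.
  have -> : (n \in slow_returns) = (slow_return n == 0).
    by apply/idP/eqP; rewrite in_setE.
  have := frac_part_itv (s2 * (slow_return n)%:~R).
  have := frac_part_sqrt2_eq0 (slow_return n).
  move: (frac_part _) => t; case: (slow_return n == 0).
    by move=> /eqP -> _; rewrite subr0 floor1.
  move=> /negbT t0 /andP[tp tl].
  have -> : Num.floor (1 - t) = 0; last by [].
  by apply: floor_def; rewrite add0r; move: t0; rewrite neq_lt; lra.
apply: gen_poly_floor; apply: gen_poly_add; first exact: gen_poly_cst.
apply: gen_poly_mul; first exact: gen_poly_cst.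
apply: gen_poly_frac_part; apply: gen_poly_mul => //; exact: gen_poly_cst.
Qed.

Lemma slow_returnsP (n : int) : slow_returns n <->
  0 <= n /\ n%:~R * frac_part (s2 * n%:~R) ^+ 2 < 1.
Proof.
rewrite /slow_returns /= /slow_return; set t := frac_part _.
split=> [/eqP|[n0 lt]]; last first.
  by apply: floor_def; rewrite add0r lt mulr_ge0 ?sqr_ge0 ?ler0z.
rewrite floor_eq add0r => /andP[ge lt]; split=> //.
rewrite leNgt; apply/negP => n0.
have n0R : n%:~R < 0 :> R by rewrite ltrz0.
have t0 : t ^+ 2 <= 0 by rewrite -(nmulr_rge0 _ n0R).
have : t == 0 by rewrite -sqrf_eq0 eq_le t0 sqr_ge0.
by rewrite frac_part_sqrt2_eq0 => /eqP n0'; rewrite n0' ltxx in n0.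
Qed.

(** Both fractional parts are below 1 / (4 K), so (n' - n) sqrt 2 is within
    1 / (4 K) of an integer, and [sqrt2_gap] applies. *)
Lemma slow_returns_separated (K n n' : nat) : (0 < K)%N ->
  ((4 * K) ^ 2 <= n)%N -> (n < n')%N ->
  slow_returns n%:Z -> slow_returns n'%:Z -> (K < n' - n)%N.
Proof.
move=> K0 Kn nn' En En'.
have K0R : 0 < K%:R :> R by rewrite ltr0n.
have small (a : nat) : ((4 * K) ^ 2 <= a)%N -> slow_returns a%:Z ->
    0 <= frac_part (s2 * a%:R) * (4 * K%:R) < 1.
  move=> Ka /slow_returnsP[_]; rewrite -pmulrn.
  have /andP[] := frac_part_itv (s2 * a%:R); set t := frac_part _ => t0 _ lt.
  rewrite mulr_ge0 ?mulr_ge0 //=.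
  rewrite -(@expr_lt1 _ 2) ?mulr_ge0 //. rewrite exprMn mulrC.
  apply: le_lt_trans lt; rewrite ler_wpM2r ?sqr_ge0 //.
  by rewrite -natrM -natrX ler_nat.
have /andP[t0 t1] := small n Kn En.
have /andP[t0' t1'] := small n' (leq_trans Kn (ltnW nn')) En'.
set p := Num.floor (s2 * n'%:R) - Num.floor (s2 * n%:R).
have d0 : (n' - n)%:Z != 0 by lia.
have := sqrt2_gap p d0; rewrite -pmulrn.
pose u := frac_part (s2 * n'%:R) - frac_part (s2 * n%:R).
have dE : s2 * (n' - n)%:R - p%:~R = u.
  by rewrite /u natrB ?(ltnW nn') // /frac_part /p rmorphB /=; ring.
rewrite dE.
have d1 : 1 <= (n' - n)%:R :> R by rewrite ler1n subn_gt0.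
have uK : `|u| * (4 * K%:R) < 1.
  have c0 : 0 <= 4 * K%:R :> R by rewrite mulr_ge0.
  rewrite -{1}(ger0_norm c0) -normrM /u mulrBl ltr_norml.
  by apply/andP; split; lra.
have u1 : `|u| <= 1.
  have := frac_part_itv (s2 * n'%:R); have := frac_part_itv (s2 * n%:R).
  by rewrite /u ler_norml => /andP[? ?] /andP[? ?]; apply/andP; split; lra.
have s2b : 0 <= s2 <= 3 / 2.
  rewrite sqrtr_ge0 /= -(@ler_pXn2r _ 2) ?nnegrE ?sqrtr_ge0 ?divr_ge0 //.
  by rewrite sqrt2_sqr; lra.
have sum : `|s2 * (n' - n)%:R + p%:~R| <= 4 * (n' - n)%:R.
  have -> : s2 * (n' - n)%:R + p%:~R = 2 * s2 * (n' - n)%:R - u.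
    by rewrite -dE; ring.
  apply: le_trans (ler_normB _ _) _; rewrite ger0_norm ?mulr_ge0 //.
  nra.
move=> gap; rewrite -(ltr_nat R) -(ltr_pM2l (_ : 0 < 4 :> R)) //.
have u0 : 0 < `|u|.
  rewrite lt_neqAle normr_ge0 andbT eq_sym; apply: contraTneq gap => ->.
  by rewrite mul0r ler10.
rewrite -(ltr_pM2l u0); apply: lt_le_trans uK _; apply: le_trans gap _.
by rewrite ler_pM2l.
Qed.

(** Beyond (4 K)^2, division by K is injective on the set. *)
Lemma count_slow_returns (K N : nat) : (0 < K)%N ->
  (count_upto slow_returns N <= (4 * K) ^ 2 + (N %/ K).+1)%N.
Proof.
move=> K0; set M := ((4 * K) ^ 2)%N.
pose e (n : nat) : bool := `[< slow_returns n%:Z >].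
pose L1 := [seq n <- iota 0 M | e n].
pose L2 := [seq n <- iota M (N.+1 - M) | e n].
have sL1 : (size L1 <= M)%N.
  by rewrite -[leqRHS](size_iota 0 M) size_filter count_size.
have sL2 : (size L2 <= (N %/ K).+1)%N.
  rewrite -(size_map (fun n => n %/ K)%N) -(size_iota 0 (N %/ K).+1).
  apply: uniq_leq_size.
    rewrite map_inj_in_uniq ?filter_uniq ?iota_uniq // => a b.
    rewrite !mem_filter !mem_iota => /andP[/asboolP Ea aM] /andP[/asboolP Eb bM] ab.
    have Ma : (M <= a)%N by lia.
    have Mb : (M <= b)%N by lia.
    have da := divn_eq a K; have db := divn_eq b K.
    have ra := ltn_pmod a K0; have rb := ltn_pmod b K0.
    have [lt|lt|//] := ltngtP a b.
      by have := slow_returns_separated K0 Ma lt Ea Eb; lia.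
    by have := slow_returns_separated K0 Mb lt Eb Ea; lia.
  move=> _ /mapP[n + ->]; rewrite mem_filter !mem_iota => /andP[_ nM].
  by rewrite add0n ltnS leq_div2r //; lia.
apply: leq_trans (leq_add sL1 sL2); rewrite -size_cat -(size_map Posz).
apply: leq_trans (size_undup _).
rewrite -card_fseq; apply: fsubset_leq_card.
have sub z : slow_returns z -> - N%:Z <= z <= N%:Z ->
    z \in [seq Posz n | n <- L1 ++ L2].
  move=> Ez; have [z0 _] := (slow_returnsP z).1 Ez.
  case: z z0 Ez => // n _ En /andP[_ nN]; apply: map_f.
  rewrite mem_cat !mem_filter !mem_iota /e; move: En => /asboolP ->; lia.
have fin : finite_set (slow_returns `&` [set z | - N%:Z <= z <= N%:Z]).
  by apply: sub_finite_set (finite_seq [seq Posz n | n <- L1 ++ L2]) => z [] /sub.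
by apply/fsubsetP => z; rewrite in_fset_set // in_setE inE => -[] /sub.
Qed.

Lemma count_slow_returns_small (e : R) : 0 < e -> exists N0 : nat,
  forall N, (N0 <= N)%N ->
    (count_upto slow_returns N)%:R <= e * (2 * N + 1)%:R.
Proof.
move=> e0.
have [K K0 Ke] : exists2 K : nat, (0 < K)%N & 1 <= K%:R * e.
  have ei : 0 <= e^-1 by rewrite invr_ge0 ltW.
  have eK := archi_boundP ei; exists (Num.bound e^-1).
    by rewrite -(ltr_nat R); apply: le_lt_trans eK.
  by rewrite -ler_pdivrMr // mul1r ltW.
pose M := ((4 * K) ^ 2).+1.
have [N0 N0P] : exists N0 : nat, M%:R <= N0%:R * e.
  have Me : 0 <= M%:R / e by rewrite divr_ge0 // ltW.
  by exists (Num.bound (M%:R / e)); rewrite -ler_pdivrMr // ltW // archi_boundP.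
exists N0 => N N0N; apply: (@le_trans _ _ (M + N %/ K)%:R).
  by rewrite ler_nat; have := count_slow_returns N K0; rewrite /M addnS addSn.
have h1 : (N %/ K)%:R <= N%:R * e.
  apply: (@le_trans _ _ ((N %/ K * K)%:R * e)).
    by rewrite natrM -mulrA ler_peMr.
  by rewrite ler_wpM2r ?(ltW e0) // ler_nat leq_trunc_div.
have h2 : M%:R <= N%:R * e.
  by apply: le_trans N0P _; rewrite ler_wpM2r ?(ltW e0) // ler_nat.
by rewrite (natrD _ M) (natrD _ (2 * N)%N) (natrM _ 2); lra.
Qed.

Lemma density_slow_returns : has_density slow_returns (0 : R).
Proof.
apply/cvgrPdist_le => e /count_slow_returns_small[N0 N0P].
exists N0 => // N /= N0N.
rewrite sub0r normrN ger0_norm ?divr_ge0 // ler_pdivrMr ?N0P //.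
Qed.

(** The solutions come from (1, 1) by multiplying p + q sqrt 2 by
    the unit 3 + 2 sqrt 2. *)
Lemma pell_unbounded B : exists p q : nat,
  [/\ (B <= q)%N, (0 < q)%N & (p ^ 2 + 1 = 2 * q ^ 2)%N].
Proof.
elim: B => [|B [p [q [Bq q0 pq]]]]; first by exists 1%N, 1%N.
exists (3 * p + 4 * q)%N, (2 * p + 3 * q)%N; split; [lia|lia|].
by move: pq; rewrite !expnS !expn0; lia.
Qed.

(** For delta = q sqrt 2 - p one has delta (q sqrt 2 + p) = 1, so delta q < 1
    and {k q sqrt 2} = k delta; the defining quantity is
    k^3 delta^2 q <= (delta q)^2 < 1. *)
Lemma slow_returns_multiple (p q k : nat) :
  (p ^ 2 + 1 = 2 * q ^ 2)%N -> (0 < q)%N -> (k ^ 3 <= q)%N ->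
  slow_returns (k * q)%:Z.
Proof.
move=> pq q0 kq; apply/slow_returnsP; split=> //; rewrite -pmulrn.
pose delta : R := s2 * q%:R - p%:R.
have pqR : p%:R ^+ 2 + 1 = 2 * q%:R ^+ 2 :> R.
  by rewrite -!natrX -natrM -pq natrD.
have p0 : (0 < p)%N.
  by case: p pq {delta pqR} => // pq; have := congr1 odd pq; rewrite oddM.
have q0R : 0 < q%:R :> R by rewrite ltr0n.
have p0R : 0 < p%:R :> R by rewrite ltr0n.
have s21 : 1 <= s2.
  rewrite -(@ler_pXn2r _ 2) ?nnegrE ?sqrtr_ge0 //.
  by rewrite sqrt2_sqr expr1n ler1n.
have key : delta * (s2 * q%:R + p%:R) = 1.
  transitivity (s2 ^+ 2 * q%:R ^+ 2 - p%:R ^+ 2); first by rewrite /delta; ring.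
  by rewrite sqrt2_sqr -pqR; ring.
have den : q%:R < s2 * q%:R + p%:R by nra.
have d0 : 0 < delta.
  by rewrite -(pmulr_lgt0 _ (lt_trans q0R den)) key.
have dq : delta * q%:R < 1 by rewrite -[ltRHS]key ltr_pM2l.
have k3 : k%:R ^+ 3 <= q%:R :> R by rewrite -natrX ler_nat.
have kq1 : (k <= q)%N.
  by apply: leq_trans kq; case: (k) => // k'; rewrite -[leqLHS]expn1 leq_pexp2l.
have kd : 0 <= k%:R * delta < 1.
  rewrite mulr_ge0 ?(ltW d0) //=; apply: le_lt_trans dq.
  by rewrite mulrC ler_wpM2l ?(ltW d0) // ler_nat.
have -> : frac_part (s2 * (k * q)%:R) = k%:R * delta.
  rewrite /frac_part (_ : Num.floor _ = (k * p)%:Z).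
    by rewrite -pmulrn !natrM /delta; ring.
  have E : s2 * (k * q)%:R = (k * p)%:R + k%:R * delta.
    by rewrite !natrM /delta; ring.
  apply: floor_def; rewrite intrD -pmulrn E; lra.
rewrite natrM exprMn.
have -> : k%:R * q%:R * (k%:R ^+ 2 * delta ^+ 2) =
  k%:R ^+ 3 * (delta ^+ 2 * q%:R) by ring.
apply: (@le_lt_trans _ _ (q%:R * (delta ^+ 2 * q%:R))).
  by rewrite ler_wpM2r // mulr_ge0 ?sqr_ge0 // ltW.
have -> : q%:R * (delta ^+ 2 * q%:R) = (delta * q%:R) ^+ 2 by ring.
by rewrite expr_lt1 // mulr_ge0 // ltW.
Qed.

Lemma ltn_poly_exp j m : exists r0, forall r, (r0 <= r)%N ->
  (r.+1 ^ j * 2 ^ m < 2 ^ r)%N.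
Proof.
pose D := j.+1.*2; exists ((D * j + m).+1.*2)%N => r rr.
set t := (r %/ D)%N.
have h1 : (r.+1 <= D * 2 ^ t)%N.
  apply: (@leq_trans (D * t.+1)%N).
    by have := ltn_ceil r (isT : 0 < D)%N; rewrite mulnC.
  by rewrite leq_mul // ltn_expl.
have h2 : (D ^ j <= 2 ^ (D * j))%N.
  by rewrite expnM leq_exp2rW // ltnW // ltn_expl.
have tj : (t * j <= r./2)%N.
  by have := leq_trunc_div r D; rewrite -/t /D; nia.
apply: (@leq_ltn_trans (2 ^ (D * j + r./2 + m))%N).
  rewrite expnD leq_mul //; apply: leq_trans (leq_exp2rW j h1) _.
  by rewrite expnMn expnD leq_mul // -expnM leq_pexp2l.
by rewrite ltn_exp2l //; lia.
Qed.

(** The multiples k q with m < k <= r, where q is a large Pell denominator and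
    r^3 <= q < (r + 1)^3; they lie below r q <= (r + 1)^4. *)
Lemma slow_returns_rich (C m : nat) : exists (N : nat) (s : seq nat),
  [/\ uniq s, forall n, n \in s -> (m < n <= N)%N /\ slow_returns n%:Z &
      (N.+2 ^ C < 2 ^ size s)%N].
Proof.
have [r0 r0P] := ltn_poly_exp (4 * C) m.
have [p [q [qB q0 pq]]] := pell_unbounded ((r0 + m).+1 ^ 3).
have exr : exists r, (r ^ 3 <= q)%N by exists 0%N.
have bdr r : (r ^ 3 <= q)%N -> (r <= q)%N.
  by apply: leq_trans; case: r => // r; rewrite -[leqLHS]expn1 leq_pexp2l.
have [r rq rmax] := ex_maxnP exr bdr.
have qr : (q < r.+1 ^ 3)%N.
  by rewrite ltnNge; apply/negP => /rmax; rewrite ltnn.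
have rB := rmax _ qB.
exists (r * q)%N, [seq (k * q)%N | k <- iota m.+1 (r - m)]; split.
- rewrite map_inj_uniq ?iota_uniq // => a b /eqP.
  by rewrite eqn_pmul2r // => /eqP.
- move=> _ /mapP[k + ->]; rewrite mem_iota => /andP[mk kr].
  have kr' : (k <= r)%N by lia.
  split; first by rewrite leq_mul2r kr' orbT andbT; nia.
  apply: slow_returns_multiple pq q0 _.
  by apply: leq_trans rq; apply: leq_exp2rW.
rewrite size_map size_iota -(ltn_pmul2r (_ : 0 < 2 ^ m)%N) ?expn_gt0 //.
rewrite -expnD subnK; last by lia.
apply: leq_ltn_trans (r0P r _); last by lia.
rewrite leq_mul2r expnM leq_exp2rW ?orbT //.
rewrite expnSr; nia.
Qed.

End SparseSet.

Theorem theoremE (R : realType) :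
  exists E : set int,
    [/\ gen_poly_set R E, has_density E (0 : R) & ~ hereditary_gen_poly R E].
Proof.
exists (slow_returns R); split.
- exact: gen_poly_slow_returns.
- exact: density_slow_returns.
- exact/not_hereditary_of_rich/slow_returns_rich.
Qed.
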